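(* Let $G$ be a locally compact Polish group with left Haar measure $\mu$, let $X$ be a separable metrizable space and let $f:G\to X$ be a Haar measurable function. Suppose $f$ is $(S,T)$ shift continuous for a Haar measurable set $S\subset G$ and a set $T\subset G$ such that either (a) $\mu(G\setminus S)=0$ and $\mu^*(T)>0$, or (b) $\mu(S)>0$ and $\mu_*(G\setminus T)=0$. Then $f$ is continuous at all points of $G$. If, moreover, $G$ is compact and $\mu$ is normalized by $\mu(G)=1$, then instead of (a) or (b) it is enough to require $\mu(S)+\mu^*(T)>1$ in order to conclude that $f$ is continuous.
   Context: The group $G$ is not assumed Abelian, but its operation is written additively. For $S,T\subset G$, a function $f:G\to X$ is called $(S,T)$ shift continuous if there exists a second countable topology $\mathcal{T}$ on the set $T$ such that for every $s_0\in S$ the function $T\to X$, $t\mapsto f(s_0+t)$, is $\mathcal{T}$-continuous. Haar measurable means measurable with respect to the completion of $\mu$. $\mu^*$ and $\mu_*$ denote the outer and inner measures associated with $\mu$. *)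

(* Defs.v *)
From HB Require Import structures.
From mathcomp Require Import all_boot all_order all_algebra.
From mathcomp Require Import all_classical all_reals all_analysis.
From mathcomp Require Import measurable_realfun.

Set Implicit Arguments.
Unset Strict Implicit.
Unset Printing Implicit Defensive.

Import Order.TTheory GRing.Theory Num.Theory.

Local Open Scope classical_set_scope.
Local Open Scope ring_scope.
Local Open Scope ereal_scope.

(* Groups are not assumed commutative.  The library reserves the additive
   notation for commutative groups, so the group law is written [(x * y)%g]. *)
HB.mixin Record isTopologicalGroup G & Topological G & Group G := {
  mulg_continuous : continuous (fun p : G * G => (p.1 * p.2)%g) ;
  invg_continuous : continuous (fun x : G => (x^-1)%g)
}.

(* The base point is there only because the library's measurable types are
   pointed; it is unrelated to the group structure. *)
#[short(type="topologicalGroupType")]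
HB.structure Definition TopologicalGroup :=
  {G of PointedTopological G & Group G & isTopologicalGroup G}.

Definition separable (T : topologicalType) :=
  exists2 D : set T, countable D & dense D.

(* A metric structure [c] on the carrier of [T] comes with its own topology,
   which is required to be the given one. *)
Definition compatible_metric (R : realType) (T : topologicalType)
    (c : Metric.axioms_ R T) :=
  forall x : T, @nbhs _ (Metric.Pack c) x = @nbhs _ T x.

Definition metrizable (R : realType) (T : topologicalType) :=
  exists c : Metric.axioms_ R T, compatible_metric c.

Definition completely_metrizable (R : realType) (T : topologicalType) :=
  exists2 c : Metric.axioms_ R T, compatible_metric c &
    forall F : set_system (Metric.Pack c), ProperFilter F -> cauchy F ->
      exists l : Metric.Pack c, F --> l.

Definition polish (R : realType) (T : topologicalType) :=
  separable T /\ completely_metrizable R T.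

Notation borel T := (g_sigma_algebraType (@open T)).

(* For a measure, the generator [completed_algebra_gen mu], i.e., the family of
   the sets [A `|` N] with [A] measurable and [N] contained in a null set, is
   already the whole completed sigma-algebra. *)
Definition completed_measurable d (T : measurableType d) (R : realType)
    (mu : {measure set T -> \bar R}) (S : set T) :=
  completed_algebra_gen mu S.

(* The completion of [mu] maps [A `|` N] to [mu A]; this does not depend on the
   decomposition, see [completed_measureE].  The value is meaningful only on
   completed measurable sets. *)
Definition completed_measure d (T : measurableType d) (R : realType)
    (mu : {measure set T -> \bar R}) (S : set T) : \bar R :=
  mu (xget set0 [set A | measurable A /\
                         exists2 N, mu.-negligible N & A `|` N = S]).

Definition inner_measure d (T : measurableType d) (R : realType)
    (mu : {measure set T -> \bar R}) (S : set T) : \bar R :=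
  ereal_sup [set mu A | A in [set A | measurable A /\ A `<=` S]].

Lemma completed_measureE d (T : measurableType d) (R : realType)
    (mu : {measure set T -> \bar R}) (A N : set T) :
  measurable A -> mu.-negligible N -> completed_measure mu (A `|` N) = mu A.
Proof.
have le (B C M : set T) : measurable B -> measurable C -> mu.-negligible M ->
    B `<=` C `|` M -> mu B <= mu C.
  move=> mB mC [P [mP P0 MP]] BCM.
  apply: (@le_trans _ _ (mu (C `|` P))).
    apply: le_measure; rewrite ?inE//; first exact: measurableU.
    by move=> x /BCM[Cx|/MP Px]; [left|right].
  apply: (le_trans (measureU2 _ mC mP)).
  by rewrite [X in _ + X]P0 adde0.
move=> mA nN; rewrite /completed_measure; case: xgetP => [B _ []|/(_ A) []].
  move=> mB [M nM BM]; apply/eqP; rewrite eq_le; apply/andP; split.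
    by apply: le nN _ => //; rewrite -BM; apply: subsetUl.
  by apply: le nM _ => //; rewrite BM; apply: subsetUl.
by split => //; exists N.
Qed.

Definition haar_measurable_fun (R : realType) (G : topologicalGroupType)
    (X : topologicalType) (mu : {measure set (borel G) -> \bar R})
    (f : G -> X) :=
  forall U : set X, open U -> completed_measurable mu (f @^-1` U).

(* A left Haar measure is a nonzero left invariant Radon measure. *)
Record left_haar (R : realType) (G : topologicalGroupType)
    (mu : {measure set (borel G) -> \bar R}) : Prop := {
  haar_neq0 : mu setT != 0 ;
  haar_left_invariant : forall (g : G) (A : set (borel G)), measurable A ->
    mu [set (g * x)%g | x in A] = mu A ;
  haar_compact : forall K : set G, compact K -> mu K < +oo ;
  haar_outer_regular : forall A : set (borel G), measurable A ->
    mu A = ereal_inf [set mu U | U in [set U : set G | open U /\ A `<=` U]] ;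
  haar_inner_regular : forall U : set G, open U ->
    mu U = ereal_sup [set mu K | K in [set K : set G | compact K /\ K `<=` U]]
}.

(* [tau] ranges over the topologies on the set [T], viewed as a type. *)
Definition shift_continuous (G : topologicalGroupType) (X : topologicalType)
    (S T : set G) (f : G -> X) :=
  exists2 tau : Topological.axioms_ T, @second_countable (Topological.Pack tau) &
    forall s0 : G, S s0 ->
      continuous (fun t : Topological.Pack tau => f (s0 * \val (t : T))%g).

(* Main.v *)
(* Fix x and an open V containing f x.  Continuity of the shifts along a
   countable base of T splits T `&` S^-1 x into countably many pieces
   B `&` A^-1 x, where s * b is sent by f into V for all s in A and b in B.  The
   size hypotheses ensure that this set is never null, so one piece is not null.
   Let C be a measurable hull of B.  Then almost every point of s * C is sent
   into V for every s in A, hence for every s in a Borel set A' containing A.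
   By Steinhaus, C `&` A'^-1 y stays non-null for y near x, and Fubini gives
   f y \in V for almost every y near x.  As f has this property at every point
   and X is regular, almost every y improves to every y. *)

Require Import Defs.
From HB Require Import structures.
From mathcomp Require Import all_boot all_order all_algebra.
From mathcomp Require Import all_classical all_reals all_analysis.
From mathcomp Require Import measurable_realfun.
From mathcomp Require Import lra.

Set Implicit Arguments.
Unset Strict Implicit.
Unset Printing Implicit Defensive.

Import Order.TTheory GRing.Theory Num.Theory.

Local Open Scope classical_set_scope.
Local Open Scope ring_scope.
Local Open Scope ereal_scope.

(** * Second countability and Borel sets of products *)

Lemma metrizable_second_countable (R : realType) (T : topologicalType) :
  separable T -> metrizable R T -> @second_countable T.
Proof.
move=> [D cD dD] [c cE].
pose N : metricType R := Metric.Pack c.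
pose b (y : T) (e : R) : set T := @ball R N y e.
exists [set (b yn.1 (yn.2.+1%:R^-1)%R)^° | yn in D `*` [set: nat]].
  by apply: (card_le_trans (card_image_le _ _)); exact: countableX.
split => [_ [yn _ <-]|x A]; first exact: open_interior.
rewrite -cE => /(@nbhs_ballP R N)[e /= e0 eA].
have e20 : (0 < e / 2)%R by rewrite divr_gt0.
have [n ne] := ltr_add_invr e20; rewrite add0r in ne.
(* As [r < e / 2], the ball of radius [r] about a point [y] within [r / 2] of [x] contains the ball
   of radius [r / 2] about [x] and stays inside the ball of radius [e]. *)
pose r : R := (n.+1%:R^-1)%R.
have r0 : (0 < r)%R by rewrite invr_gt0.
have nx (s : R) : (0 < s)%R -> nbhs x (b x s).
  by move=> s0; rewrite -cE; exact: (@nbhsx_ballx R N).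
have xr : nbhs x (b x (r / 2)%R) by apply: nx; rewrite divr_gt0.
have [|y [/interior_subset xy Dy]] :=
  dD (b x (r / 2)%R)^° _ (@open_interior _ _).
  by exists x.
exists (b y r)^° => /=.
  split; first by exists (y, n).
  apply: (filterS _ xr) => z xz; rewrite /b (splitr r).
  exact: (@ball_triangle R N x) (@ball_sym R N _ _ _ xy) xz.
move=> z /interior_subset yz; apply: eA.
apply: (@le_ball R N) (@ball_triangle R N y _ _ _ _ xy yz).
rewrite [leRHS]splitr lerD// ltW// (le_lt_trans _ ne)//.
by rewrite ler_piMr ?ltW// invf_lt1 ?ltr1n.
Qed.

Lemma countable_enum (I : Type) (A : set I) (i0 : I) :
  countable A -> A i0 -> exists e : nat -> I, A = range e.
Proof.
move=> cA Ai0; have [A0|[e]] := pfcard_geP cA.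
  by move: Ai0; rewrite A0.
by exists e; rewrite image_eq.
Qed.

Lemma countable_bigcup_measurable d (T : sigmaRingType d) (I : Type)
    (A : set I) (F : I -> set T) :
  countable A -> (forall i, A i -> measurable (F i)) ->
  measurable (\bigcup_(i in A) F i).
Proof.
move=> cA mF; have [->|/set0P[i0 Ai0]] := eqVneq A set0.
  by rewrite bigcup_set0.
have [e Ae] := countable_enum cA Ai0.
rewrite Ae bigcup_image; apply: bigcupT_measurable => n.
by apply: mF; rewrite Ae; exists n.
Qed.

(** An open set is the union of the basic rectangles inside it, and there are only countably many of
    these. This makes the group law measurable for the product of the Borel sigma-algebras, as
    Fubini requires. *)
Lemma open_setX_measurable (T U : ptopologicalType) (O : set (T * U)) :
  @second_countable T -> @second_countable U -> open O ->
  measurable (O : set (borel T * borel U)).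
Proof.
move=> [A cA [oA bA]] [B cB [oB bB]] oO.
pose I := [set UV : set T * set U | (A `*` B) UV /\ UV.1 `*` UV.2 `<=` O].
have cI : countable I.
  by apply: (sub_countable _ (countableX cA cB)); apply: subset_card_le => ? [].
rewrite (_ : O = \bigcup_(UV in I) (UV.1 `*` UV.2)); last first.
  apply/seteqP; split => [[x y] Oxy|z [UV [_ +]]]; last exact.
  have [[P Q] [/= xP yQ] PQ] : nbhs (x, y) O by exact: open_nbhs_nbhs.
  have [V [AV Vx] VP] := bA x _ xP.
  have [W [BW Wy] WQ] := bB y _ yQ.
  exists (V, W); last by [].
  by split => // -[s t] [/= /VP Ps /WQ Qt]; exact: PQ.
apply: countable_bigcup_measurable => // -[V W] [[AV BW] _] /=.
by apply: measurableX; apply: sub_sigma_algebra; [exact: oA|exact: oB].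
Qed.

Lemma borel_continuous_measurable (T U : ptopologicalType) (f : T -> U) :
  continuous f -> measurable_fun setT (f : borel T -> borel U).
Proof.
move=> cf; apply: (@measurability _ _ (borel T) (borel U) setT f (@open U)).
  by [].
move=> _ [V oV <-].
by rewrite setTI; apply: sub_sigma_algebra; exact: open_comp.
Qed.

Lemma borel_continuous2_measurable (T U V : ptopologicalType)
    (f : T * U -> V) :
  @second_countable T -> @second_countable U -> continuous f ->
  measurable_fun setT (f : borel T * borel U -> borel V).
Proof.
move=> sT sU cf.
apply: (@measurability _ _ (borel T * borel U)%type (borel V) setT f (@open V)).
  by [].
move=> _ [W oW <-].
rewrite setTI; apply: open_setX_measurable => //.
by apply: open_comp.
Qed.

Lemma continuous_preimage_measurable (T U : ptopologicalType) (f : T -> U)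
    (A : set (borel U)) :
  continuous f -> measurable A -> measurable (f @^-1` A : set (borel T)).
Proof.
move=> cf mA; rewrite -[X in measurable X]setTI.
exact: (borel_continuous_measurable cf).
Qed.

Lemma continuous2_preimage_measurable (T U V : ptopologicalType)
    (f : T * U -> V) (A : set (borel V)) :
  @second_countable T -> @second_countable U -> continuous f ->
  measurable A -> measurable (f @^-1` A : set (borel T * borel U)).
Proof.
move=> sT sU cf mA; rewrite -[X in measurable X]setTI.
exact: (borel_continuous2_measurable sT sU cf).
Qed.

Lemma closed_borel_measurable (T : ptopologicalType) (A : set T) :
  closed A -> measurable (A : set (borel T)).
Proof.
move=> cA; rewrite -[X in measurable X]setCK; apply: measurableC.
by apply: sub_sigma_algebra; exact: closed_openC.
Qed.

(** * Sections of sets in a product of sigma-finite spaces *)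

Lemma integral_xsection_ysection d1 d2 (T1 : measurableType d1)
    (T2 : measurableType d2) (R : realType) (m1 : {measure set T1 -> \bar R})
    (m2 : {measure set T2 -> \bar R}) (A : set (T1 * T2)) :
  sigma_finite setT m1 -> sigma_finite setT m2 -> measurable A ->
  \int[m1]_x m2 (xsection A x) = \int[m2]_y m1 (ysection A y).
Proof.
move=> s1 s2 mA.
(* Tonelli's theorem is stated for bundled sigma-finite measures, so these structures are built on
   [m1] and [m2] from the hypotheses. *)
pose f1 := isSFinite.Build _ _ _ _ (sfinite_measure_sigma_finite s1).
pose f2 := isSFinite.Build _ _ _ _ (sfinite_measure_sigma_finite s2).
pose g1 := isSigmaFinite.Build _ _ _ _ s1.
pose g2 := isSigmaFinite.Build _ _ _ _ s2.
pose n1 := HB.pack_for (SigmaFiniteMeasure.type T1 R) (Measure.sort m1) f1 g1.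
pose n2 := HB.pack_for (SigmaFiniteMeasure.type T2 R) (Measure.sort m2) f2 g2.
have := indic_fubini_tonelli n1 n2 mA.
by rewrite indic_fubini_tonelli_FE// indic_fubini_tonelli_GE.
Qed.

Lemma xsection_measure_measurable d1 d2 (T1 : measurableType d1)
    (T2 : measurableType d2) (R : realType)
    (m : {measure set T2 -> \bar R}) (A : set (T1 * T2)) :
  sigma_finite setT m -> measurable A ->
  measurable_fun setT (fun x => m (xsection A x)).
Proof.
move=> s mA.
pose f := isSFinite.Build _ _ _ _ (sfinite_measure_sigma_finite s).
pose g := isSigmaFinite.Build _ _ _ _ s.
pose n := HB.pack_for (SigmaFiniteMeasure.type T2 R) (Measure.sort m) f g.
exact: (measurable_fun_xsection n mA).
Qed.

Lemma ysection_measure_measurable d1 d2 (T1 : measurableType d1)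
    (T2 : measurableType d2) (R : realType)
    (m : {measure set T1 -> \bar R}) (A : set (T1 * T2)) :
  sigma_finite setT m -> measurable A ->
  measurable_fun setT (fun y => m (ysection A y)).
Proof.
move=> s mA.
pose f := isSFinite.Build _ _ _ _ (sfinite_measure_sigma_finite s).
pose g := isSigmaFinite.Build _ _ _ _ s.
pose n := HB.pack_for (SigmaFiniteMeasure.type T1 R) (Measure.sort m) f g.
exact: (measurable_fun_ysection n mA).
Qed.

Lemma integral_ge0_eq0 d (T : measurableType d) (R : realType)
    (m : {measure set T -> \bar R}) (f : T -> \bar R) :
  measurable_fun setT f -> (forall x, 0 <= f x) ->
  \int[m]_x f x = 0 <-> m.-negligible [set x | f x != 0].
Proof.
move=> mf f0.
have -> : [set x | f x != 0] = ~` [set x | setT x -> f x = cst 0 x].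
  apply/seteqP; split => [x /eqP fx /(_ I)//|x /= fx].
  by apply/eqP => fx0; apply: fx.
have <- : \int[m]_x `|f x| = \int[m]_x f x.
  by apply: eq_integral => x _; rewrite gee0_abs.
exact: (ae_eq_integral_abs m measurableT mf).
Qed.

(** By Tonelli both section functions have the same integral, and a nonnegative function has
    integral zero exactly when it vanishes almost everywhere. *)
Lemma negligible_ysection d1 d2 (T1 : measurableType d1)
    (T2 : measurableType d2) (R : realType) (m1 : {measure set T1 -> \bar R})
    (m2 : {measure set T2 -> \bar R}) (A : set (T1 * T2)) :
  sigma_finite setT m1 -> sigma_finite setT m2 -> measurable A ->
  m1.-negligible [set x | m2 (xsection A x) != 0] ->
  m2.-negligible [set y | m1 (ysection A y) != 0].
Proof.
move=> s1 s2 mA.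
move/(integral_ge0_eq0 m1 (xsection_measure_measurable s2 mA)) => /(_ _)A0.
apply/(integral_ge0_eq0 m2 (ysection_measure_measurable s1 mA)) => //.
by rewrite -(integral_xsection_ysection s1 s2 mA) A0.
Qed.

(** * Translations, inversion and Haar null sets *)

Lemma continuous_mulg (G : topologicalGroupType) (T : topologicalType)
    (f h : T -> G) :
  continuous f -> continuous h -> continuous (fun x => (f x * h x)%g).
Proof.
move=> cf ch x; apply: (@continuous_comp _ _ _ (fun x => (f x, h x))
  (fun p : G * G => (p.1 * p.2)%g)); last exact: mulg_continuous.
by apply: cvg_pair; [exact: cf|exact: ch].
Qed.

Lemma continuous_invg (G : topologicalGroupType) (T : topologicalType)
    (f : T -> G) :
  continuous f -> continuous (fun x => ((f x)^-1)%g).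
Proof.
by move=> cf x; exact: (continuous_comp (cf x) (@invg_continuous G (f x))).
Qed.

Lemma mulg_left_continuous (G : topologicalGroupType) (g : G) :
  continuous (fun x : G => (g * x)%g).
Proof. by apply: continuous_mulg => x; [exact: cvg_cst|exact: cvg_id]. Qed.

(** The condition on [d] holds for all [d] near [x * w^-1], hence for some point of [D]. For
    countable [D] this covers the group by countably many left translates of [W]. *)
Lemma dense_translates (G : topologicalGroupType) (D W : set G) (w : G) :
  dense D -> nbhs w W -> forall x, exists2 d, D d & W (d^-1 * x)%g.
Proof.
move=> dD wW x.
pose f (d : G) : G := (d^-1 * x)%g.
have cf : continuous f.
  by apply: continuous_mulg; [exact: invg_continuous|move=> d; exact: cvg_cst].
have fx : f (x * w^-1)%g = w by rewrite /f invgM invgK mulgVK.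
have xW : nbhs (x * w^-1)%g (f @^-1` W) by apply: cf; rewrite fx.
have [|d [/interior_subset Wd Dd]] := dD _ _ (@open_interior _ (f @^-1` W)).
  by exists (x * w^-1)%g.
by exists d.
Qed.

Lemma haar_translate (R : realType) (G : topologicalGroupType)
    (mu : {measure set (borel G) -> \bar R}) (g : G) (A : set (borel G)) :
  left_haar mu -> measurable A -> mu [set x | A (g * x)%g] = mu A.
Proof.
move=> haar mA; rewrite -[RHS](haar_left_invariant haar g^-1%g)//; congr (mu _).
apply/seteqP; split => [x Agx|_ [x Ax <-]] /=; last by rewrite mulVKg.
by exists (g * x)%g => //; rewrite mulKg.
Qed.

Lemma translate_measurable (G : topologicalGroupType) (g : G)
    (A : set (borel G)) :
  measurable A -> measurable ([set x | A (g * x)%g] : set (borel G)).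
Proof.
exact: (continuous_preimage_measurable (@mulg_left_continuous G g)).
Qed.

(** Countably many translates of a compact neighbourhood of the identity cover the group, and each
    has finite measure. *)
Lemma haar_sigma_finite (R : realType) (G : topologicalGroupType)
    (mu : {measure set (borel G) -> \bar R}) :
  locally_compact [set: G] -> separable G -> left_haar mu ->
  sigma_finite setT mu.
Proof.
move=> lcG [D cD dD] haar.
have [K nK [cK clK]] : exists2 K : set G, nbhs 1%g K & compact K /\ closed K.
  have [K K1 cK] := lcG 1%g I; exists K => //.
  have K1n : nbhs (1%g : G) [set x | setT x -> K x] := K1.
  by apply: filterS K1n => x /(_ I).
have [d0 D0 _] := dense_translates dD nK 1%g.
have [e De] := countable_enum cD D0.
have mK : measurable (K : set (borel G)).
  exact: closed_borel_measurable.
exists (fun n => [set x | K ((e n)^-1 * x)%g]).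
  apply/seteqP; split => // x _.
  have [d] := dense_translates dD nK x; rewrite De => -[n _ <-] Kx.
  by exists n.
move=> n; split; first exact: translate_measurable.
by rewrite haar_translate//; exact: haar_compact.
Qed.

(** Countably many translates of [W] cover the group, so a null [W] would force [mu setT = 0]. *)
Lemma haar_nbhs_not_negligible (R : realType) (G : topologicalGroupType)
    (mu : {measure set (borel G) -> \bar R}) (x : G) (W : set G) :
  separable G -> left_haar mu -> nbhs x W -> ~ mu.-negligible W.
Proof.
move=> [D cD dD] haar xW nW.
have [d0 D0 _] := dense_translates dD xW 1%g.
have [e De] := countable_enum cD D0.
have [A [mA A0 WA]] := nW.
have /eqP := haar_neq0 haar; apply; apply/negligibleP => //.
pose N : set (borel G) := \bigcup_n [set x : G | A ((e n)^-1 * x)%g].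
apply: (@negligibleS _ _ _ _ N).
  move=> y _; have [d] := dense_translates dD xW y.
  by rewrite De => -[n _ <-] /WA Ay; exists n.
apply: negligible_bigcup => n; apply/negligibleP.
  exact: translate_measurable.
exact: etrans (haar_translate _ haar mA) A0.
Qed.

(** Both sides compute the product measure of the pairs with [x^-1 * y] in [A]: the sections are
    left translates of [A] in one direction and of its inverse in the other. If [mu setT] is
    infinite, the identity still says that inversion preserves null sets, which avoids the modular
    function; if [mu setT = 1], it gives invariance under inversion. *)
Lemma haar_inv_mul (R : realType) (G : topologicalGroupType)
    (mu : {measure set (borel G) -> \bar R}) (A : set (borel G)) :
  @second_countable G -> sigma_finite setT mu -> left_haar mu ->
  measurable A -> mu [set x | A (x^-1)%g] * mu setT = mu A * mu setT.
Proof.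
move=> sG sf haar mA.
pose E : set (borel G * borel G) := [set p | A (p.1^-1 * p.2)%g].
have mE : measurable E.
  apply: (continuous2_preimage_measurable
    (f := fun p : G * G => (p.1^-1 * p.2)%g)) => //.
  apply: continuous_mulg; last by move=> p; exact: cvg_snd.
  by apply: continuous_invg => p; exact: cvg_fst.
have mi : measurable ([set x | A (x^-1)%g] : set (borel G)).
  exact: (continuous_preimage_measurable (@invg_continuous G)).
have := integral_xsection_ysection sf sf mE.
rewrite (eq_integral (cst (mu A))); last first.
  move=> y _; rewrite -[RHS](haar_translate y^-1%g haar mA).
  by congr (mu _); apply/seteqP; split => x; rewrite xsectionE.
rewrite [X in _ = X](eq_integral (cst (mu [set x | A (x^-1)%g]))); last first.
  move=> y _; rewrite -[RHS](haar_translate y^-1%g haar mi).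
  congr (mu _); apply/seteqP; split => x;
  by rewrite ysectionE/= invgM invgK.
by rewrite !integral_cst.
Qed.

Lemma haar_inv_null (R : realType) (G : topologicalGroupType)
    (mu : {measure set (borel G) -> \bar R}) (A : set (borel G)) :
  @second_countable G -> sigma_finite setT mu -> left_haar mu ->
  measurable A -> mu A = 0 -> mu [set x | A (x^-1)%g] = 0.
Proof.
move=> sG sf haar mA A0; have /eqP := haar_inv_mul sG sf haar mA.
by rewrite A0 mul0e mule_eq0 (negbTE (haar_neq0 haar)) orbF => /eqP.
Qed.

(** A right translation is a left translation conjugated by inversion, and each of these maps
    preserves null sets. *)
Lemma haar_right_null (R : realType) (G : topologicalGroupType)
    (mu : {measure set (borel G) -> \bar R}) (g : G) (A : set (borel G)) :
  @second_countable G -> sigma_finite setT mu -> left_haar mu ->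
  measurable A -> mu A = 0 -> mu [set x | A (x * g)%g] = 0.
Proof.
move=> sG sf haar mA A0.
have mi : measurable ([set x | A (x^-1)%g] : set (borel G)).
  exact: (continuous_preimage_measurable (@invg_continuous G)).
pose B : set (borel G) := [set x | A ((g^-1 * x)^-1)%g].
have mB : measurable B by exact: (translate_measurable g^-1%g mi).
have -> : [set x | A (x * g)%g] = [set x | B (x^-1)%g].
  by apply/seteqP; split => x; rewrite /B /= invgM !invgK.
apply: haar_inv_null => //.
by rewrite (haar_translate g^-1%g haar mi) (haar_inv_null sG sf haar mA A0).
Qed.

Lemma haar_div_null (R : realType) (G : topologicalGroupType)
    (mu : {measure set (borel G) -> \bar R}) (x : G) (A : set (borel G)) :
  @second_countable G -> sigma_finite setT mu -> left_haar mu ->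
  measurable A ->
  mu [set t | A (x * t^-1)%g] = 0 <-> mu A = 0.
Proof.
move=> sG sf haar mA; pose B : set (borel G) := [set u | A (x * u)%g].
have mB : measurable B by exact: translate_measurable.
rewrite -(haar_translate x haar mA) -/B; split => [C0|].
  rewrite (_ : B = [set t | [set t | B (t^-1)%g] (t^-1)%g]).
    apply: haar_inv_null => //.
    exact: (continuous_preimage_measurable (@invg_continuous G)).
  by apply/seteqP; split => t /=; rewrite invgK.
exact: haar_inv_null.
Qed.

(** * Steinhaus' argument and the double use of Fubini *)

(** Squeeze most of [Q] between a compact [K] and an open [U]. For [z] near the identity,
    [Q' = Q & K] and its translate by [z^-1] both lie in [U], whose measure is less than twice that
    of [Q'], so they overlap in positive measure. *)
Lemma haar_steinhaus (R : realType) (G : topologicalGroupType)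
    (mu : {measure set (borel G) -> \bar R}) (Q : set (borel G)) :
  hausdorff_space G -> left_haar mu -> measurable Q ->
  0 < mu Q -> mu Q < +oo ->
  \forall z \near (1%g : G), 0 < mu (Q `&` [set x | Q (z * x)%g]).
Proof.
move=> hG haar mQ Q0 Qoo.
have [a Qa] : exists a, mu Q = a%:E.
  by exists (fine (mu Q)); rewrite fineK// ge0_fin_numE.
have a0 : (0 < a)%R by rewrite -lte_fin -Qa.
have [_ [U [oU QU] <-]] : exists2 y,
    [set mu U | U in [set U : set G | open U /\ Q `<=` U]] y &
    y < (a + a / 8)%:E.
  apply: ereal_inf_lt; rewrite -haar_outer_regular// Qa lte_fin.
  by rewrite ltrDl divr_gt0.
have mU : measurable (U : set (borel G)) by exact: sub_sigma_algebra.
move=> Ua; have [u Uu] : exists u, mu U = u%:E.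
  exists (fine (mu U)); rewrite fineK// ge0_fin_numE//.
  by rewrite (lt_trans Ua)// ltry.
have [_ [K [cK KU] <-]] : exists2 y,
    [set mu K | K in [set K : set G | compact K /\ K `<=` U]] y &
    (u - a / 8)%:E < y.
  apply: ereal_sup_gt; rewrite -haar_inner_regular// Uu lte_fin.
  by rewrite gtrBl divr_gt0.
have mK : measurable (K : set (borel G)).
  exact: closed_borel_measurable (compact_closed hG cK).
move=> uK.
pose Q' : set (borel G) := Q `&` K.
have mQ' : measurable Q' by exact: measurableI.
have [q Qq] : exists q, mu Q' = q%:E.
  exists (fine (mu Q')); rewrite fineK// ge0_fin_numE//.
  by rewrite (le_lt_trans _ Qoo)// measureIl.
(* The two errors [a / 8] give [q > 7a/8], whereas [u < 9a/8]. *)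
have uq : (u < q + q)%R.
  have Uaq : mu U = mu (U `\` Q) + a%:E.
    rewrite -Qa (measureDI mu mU mQ); congr (_ + mu _).
    by apply/seteqP; split => [x []//|x Qx]; split => //; exact: QU.
  have Kle : mu K <= mu (U `\` Q) + q%:E.
    rewrite -Qq (measureDI mu mK mQ) setIC leeD2r// le_measure ?inE//.
    - exact: measurableD.
    - exact: measurableD.
    - by move=> x [/KU].
  move: Uaq Kle uK Ua; rewrite Uu.
  case: (mu (U `\` Q)) (measure_ge0 mu (U `\` Q)) => [d _|//|//].
  case: (mu K) => [k||]; rewrite ?lte_fin ?lee_fin//; last first.
  move=> [->] kdq uk ua.
  lra.
(* Each point of [K] has its own neighbourhood of the identity; compactness makes the choice of [z]
   uniform over [K]. *)
have nearK : \forall z \near (1%g : G), K `<=` [set x | U (z^-1 * x)%g].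
  apply: (iffLR (compact_near_coveringP K) cK) => x Kx.
  have cd : continuous (fun p : G * G => (p.2^-1 * p.1)%g).
    apply: continuous_mulg; last by move=> p; exact: cvg_fst.
    by apply: continuous_invg => p; exact: cvg_snd.
  apply: (cd (x, 1%g)); rewrite /= invg1 mul1g.
  by apply: open_nbhs_nbhs; split => //; exact: KU.
near=> z.
pose P : set (borel G) := [set x | Q' (z * x)%g].
have mP : measurable P by exact: translate_measurable.
have PQ : mu P = q%:E by rewrite -Qq; exact: haar_translate.
have PU : P `<=` U.
  move=> x [_ Kzx]; rewrite -[x](mulKg z).
  by move: Kzx; move: (z * x)%g; near: z.
have /lt_le_trans : 0 < mu (Q' `&` P).
  rewrite lt0e measure_ge0 andbT; apply/eqP => P0.
  have : mu (Q' `|` P) <= mu U.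
    apply: le_measure; rewrite ?inE//; first exact: measurableU.
    by move=> x [[_ /KU]|/PU].
  rewrite measureUfinl ?Qq ?ltry//= P0 PQ Uu oppe0 adde0 -EFinD lee_fin.
  by rewrite leNgt uq.
apply; apply: le_measure; rewrite ?inE//; last first.
  by move=> x [[Qx _] [Qzx _]].
- by apply: measurableI => //; exact: translate_measurable.
- exact: measurableI.
Unshelve. all: by end_near. Qed.

Lemma sigma_finite_positive_subset d (T : measurableType d) (R : realType)
    (m : {measure set T -> \bar R}) (A : set T) :
  sigma_finite setT m -> measurable A -> m A != 0 ->
  exists Q, [/\ measurable Q, Q `<=` A, 0 < m Q & m Q < +oo].
Proof.
move=> [F FT mF] mA A0.
have [n An] : exists n, m (A `&` F n) != 0.
  apply: contrapT => /forallNP An; move/eqP: A0; apply.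
  apply/negligibleP => //; rewrite -[A]setIT FT setI_bigcupr.
  apply: negligible_bigcup => n; apply/negligibleP.
    by apply: measurableI => //; exact: (mF n).1.
  by apply/eqP/negPn/negP; exact: An.
have mAF : measurable (A `&` F n) by apply: measurableI => //; exact: (mF n).1.
exists (A `&` F n); split => //; first by rewrite lt0e An measure_ge0.
by apply: le_lt_trans (mF n).2; apply: measureIr => //; exact: (mF n).1.
Qed.

(** The set is the zero set of the measure of sections of a Borel subset of the product. It will be
    the Borel replacement for a possibly non-measurable set of shifts. *)
Lemma null_shifts_measurable (R : realType) (G : topologicalGroupType)
    (mu : {measure set (borel G) -> \bar R}) (C M : set (borel G)) :
  @second_countable G -> sigma_finite setT mu -> measurable C ->
  measurable M ->
  measurable ([set s | mu (C `&` [set c | M (s * c)%g]) = 0] : set (borel G)).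
Proof.
move=> sG sf mC mM.
pose E : set (borel G * borel G) := [set p | C p.2 /\ M (p.1 * p.2)%g].
have mE : measurable E.
  apply: measurableI.
    apply: (continuous2_preimage_measurable (f := fun p : G * G => p.2)) => //.
    by move=> p; exact: cvg_snd.
  apply: (continuous2_preimage_measurable
    (f := fun p : G * G => (p.1 * p.2)%g)) => //.
  exact: mulg_continuous.
have := xsection_measure_measurable sf mE measurableT (emeasurable_set1 0).
rewrite setTI; congr measurable; apply/seteqP.
by split => s /=; rewrite xsectionE.
Qed.

(* Fubini twice: for almost every [u], almost every [y] with [A (y * u)] and
   [C u^-1] lies outside [M]. *)
Lemma haar_near_null (R : realType) (G : topologicalGroupType)
    (mu : {measure set (borel G) -> \bar R}) (C M : set (borel G)) (x : G) :
  @second_countable G -> hausdorff_space G -> sigma_finite setT mu ->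
  left_haar mu -> measurable C -> measurable M ->
  let A := [set s | mu (C `&` [set c | M (s * c)%g]) = 0] in
  mu (C `&` [set c | A (x * c^-1)%g]) != 0 ->
  exists2 O, nbhs x O & mu.-negligible (O `&` M).
Proof.
move=> sG hG sf haar mC mM A xA.
have cfst : continuous (fun p : G * G => p.1) by move=> p; exact: cvg_fst.
have csnd : continuous (fun p : G * G => p.2) by move=> p; exact: cvg_snd.
have mpre (f : G * G -> G) (B : set (borel G)) : continuous f ->
    measurable B -> measurable (f @^-1` B : set (borel G * borel G)).
  by move=> cf mB; exact: (continuous2_preimage_measurable sG sG cf).
have mA : measurable (A : set (borel G)) by exact: null_shifts_measurable.
(* Substituting [u = c^-1] turns the set of [c] in the hypothesis into [P x], on which left
   translations act without inverses. *)
pose P (y : G) : set (borel G) := [set u | C (u^-1)%g /\ A (y * u)%g].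
have mCi : measurable ([set u | C (u^-1)%g] : set (borel G)).
  exact: (continuous_preimage_measurable (@invg_continuous G)).
have mP y : measurable (P y).
  by apply: measurableI => //; exact: (translate_measurable _ mA).
have Px : mu (P x) != 0.
  apply: contra_neq xA => Px0; rewrite -(haar_inv_null sG sf haar (mP x) Px0).
  by congr (mu _); apply/seteqP; split => c; rewrite /P /= invgK.
have [Q [mQ QP Q0 Qoo]] := sigma_finite_positive_subset sf (mP x) Px.
(* This is a neighbourhood of [x] by Steinhaus at [x^-1 * y]: if [u] and [x^-1 * y * u] both lie in
   [Q], a subset of [P x], then [u] lies in [P y]. *)
exists [set y | mu (P y) != 0].
  have cx : continuous (fun y => x^-1 * y)%g by exact: mulg_left_continuous.
  have nQ := haar_steinhaus hG haar mQ Q0 Qoo.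
  rewrite -(mulVg x) in nQ.
  have xQ : nbhs x [set y | 0 < mu (Q `&` [set u | Q (x^-1 * y * u)%g])].
    exact: cx _ nQ.
  apply: filterS xQ => y Qy.
  apply/eqP => Py0.
  have : mu (Q `&` [set u | Q (x^-1 * y * u)%g]) = 0.
    apply: subset_measure0 Py0 => //.
    - by apply: measurableI => //; exact: translate_measurable.
    - move=> u [/QP[Cu _] /QP[_]]; rewrite -mulgA mulVKg.
      by split.
  by move=> Q0'; move: Qy; rewrite /= Q0' ltxx.
(* For [s] in [A] the section of [E1] is the inverse of a set that is null by the definition of [A];
   for other [s] it is empty. So almost every section at fixed [u] is null too. *)
pose E1 : set (borel G * borel G) :=
  [set p | A p.1 /\ C (p.2^-1)%g /\ M (p.1 * p.2^-1)%g].
have mE1 : measurable E1.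
  apply: measurableI; first exact: (mpre (fun p => p.1)).
  apply: measurableI.
    by apply: (mpre (fun p => p.2^-1)%g) => //; exact: continuous_invg.
  apply: (mpre (fun p => p.1 * p.2^-1)%g) => //; apply: continuous_mulg => //.
  exact: continuous_invg.
have N1 : mu.-negligible [set s | mu (xsection E1 s) != 0].
  rewrite (_ : mkset _ = set0); first exact: negligible_set0.
  rewrite -subset0 => s /= /eqP; apply.
  have [As|nAs] := pselect (A s); last first.
    by rewrite (_ : xsection _ _ = set0) ?measure0// -subset0 => u;
      rewrite xsectionE => -[].
  rewrite -(haar_inv_null sG sf haar _ As).
    congr (mu _); apply/seteqP; split => u; rewrite xsectionE; first by case.
    by [].
  by apply: measurableI => //; exact: (translate_measurable _ mM).
(* This is [E1] in the variables [u] and [y = s * u^-1]. At fixed [u] the change is a right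
   translation, so null sections stay null. At fixed [y] in [M] the section is exactly [P y], and
   the second Fubini makes it null for almost every such [y]. *)
pose E2 : set (borel G * borel G) :=
  [set p | C (p.1^-1)%g /\ A (p.2 * p.1)%g /\ M p.2].
have mE2 : measurable E2.
  apply: measurableI.
    by apply: (mpre (fun p => p.1^-1)%g) => //; exact: continuous_invg.
  apply: measurableI; last exact: (mpre (fun p => p.2)).
  by apply: (mpre (fun p => p.2 * p.1)%g) => //; exact: continuous_mulg.
have N2 : mu.-negligible [set u | mu (xsection E2 u) != 0].
  apply: negligibleS (negligible_ysection sf sf mE1 N1) => u /= E2u.
  apply: contra_neq E2u => E1u.
  have mE1u := measurable_ysection u mE1.
  rewrite -(haar_right_null u sG sf haar mE1u E1u); congr (mu _).
  apply/seteqP; split => y; rewrite xsectionE /= ysectionE /E1 /E2 /= mulgK;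
    tauto.
apply: negligibleS (negligible_ysection sf sf mE2 N2) => y [/= Py My].
rewrite (_ : ysection E2 y = P y)//.
by apply/seteqP; split => u; rewrite ysectionE /=; [case=> ? []|case].
Qed.

(** * Measurable hulls for the outer measure *)

(** Intersect measurable supersets of [B] whose measures exceed the outer measure by less than
    [1/(n+1)]. If the outer measure is infinite, the whole space serves. *)
Lemma mu_ext_hull d (T : measurableType d) (R : realType)
    (m : {measure set T -> \bar R}) (B : set T) :
  exists C, [/\ measurable C, B `<=` C & m C = mu_ext m B].
Proof.
have [Boo|] := eqVneq (mu_ext m B) +oo.
  exists setT; split => //; apply/eqP; rewrite Boo -leye_eq -Boo.
  by rewrite -(measurable_mu_extE m measurableT); exact: le_mu_ext.
move=> Boo.
have Bfin : mu_ext m B \is a fin_num.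
  by rewrite ge0_fin_numE ?mu_ext_ge0 ?ltey.
have ex (n : nat) : exists A, [/\ measurable A, B `<=` A &
    m A < mu_ext m B + (n.+1%:R^-1)%:E].
  have [_ [F [mF BF] <-] Flt] : exists2 y,
      [set \sum_(k <oo) m (A k) | A in measurable_cover B] y &
      y < mu_ext m B + (n.+1%:R^-1)%:E.
    by apply: ereal_inf_lt; rewrite -/(mu_ext m B) lteDl// lte_fin invr_gt0.
  exists (\bigcup_k F k); split => //; first exact: bigcupT_measurable.
  apply: le_lt_trans Flt; apply: generalized_Boole_inequality => //.
  exact: bigcupT_measurable.
have [A AP] := choice ex.
have mA : measurable (\bigcap_n A n).
  by apply: bigcapT_measurable => n; case: (AP n).
have BA : B `<=` \bigcap_n A n.
  by move=> x Bx n _; have [_ BA _] := AP n; exact: BA.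
exists (\bigcap_n A n); split => //.
apply/eqP; rewrite eq_le; apply/andP; split; last first.
  by rewrite -(measurable_mu_extE m mA); exact: le_mu_ext.
apply/lee_addgt0Pr => e e0.
have [n] := ltr_add_invr e0; rewrite add0r => ne.
have [mAn _ /ltW An] := AP n.
have : m (\bigcap_n A n) <= m (A n).
  by apply: le_measure; rewrite ?inE// => x /(_ n I).
move=> /le_trans; apply.
by rewrite (le_trans An)// leeD2l// lee_fin ltW.
Qed.

Lemma negligible_mu_ext d (T : measurableType d) (R : realType)
    (m : {measure set T -> \bar R}) (B : set T) :
  m.-negligible B <-> mu_ext m B = 0.
Proof.
split=> [[C [mC C0 BC]]|B0].
  apply/eqP; rewrite eq_le mu_ext_ge0// andbT -C0 -(measurable_mu_extE m mC).
  exact: le_mu_ext.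
have [C [mC BC CB]] := mu_ext_hull m B.
by exists C; split => //; rewrite CB.
Qed.

(** Removing [D] from the hull [C] still leaves a cover of [B], so no measure can be lost;
    finiteness permits the cancellation. *)
Lemma hull_disjoint_null d (T : measurableType d) (R : realType)
    (m : {measure set T -> \bar R}) (B C D : set T) :
  measurable C -> B `<=` C -> m C = mu_ext m B -> mu_ext m B < +oo ->
  measurable D -> D `&` B = set0 -> m (C `&` D) = 0.
Proof.
move=> mC BC CB Boo mD DB.
have mCD : measurable (C `\` D) by exact: measurableD.
have : m (C `\` D) + m (C `&` D) <= m (C `\` D).
  have -> : m (C `\` D) + m (C `&` D) = m C by exact/esym/measureDI.
  rewrite CB -(measurable_mu_extE m mCD); apply: le_mu_ext => x Bx.
  split; first exact: BC.
  by move=> Dx; have : (D `&` B) x by []; rewrite DB.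
have : m (C `\` D) \is a fin_num.
  rewrite ge0_fin_numE//; apply: le_lt_trans Boo; rewrite -CB.
  by apply: le_measure; rewrite ?inE// => x [].
have : 0 <= m (C `&` D) by [].
case: (m (C `\` D)) => // r; case: (m (C `&` D)) => // s.
by rewrite -EFinD !lee_fin => s0 _ rs; congr EFin; lra.
Qed.

(** * From shift continuity to continuity *)

Lemma shift_continuous_near_ae (R : realType) (G : topologicalGroupType)
    (mu : {measure set (borel G) -> \bar R}) (X : topologicalType)
    (f : G -> X) (S T : set G) (V : set X) (x : G) :
  @second_countable G -> hausdorff_space G -> sigma_finite setT mu ->
  left_haar mu -> open V -> V (f x) -> completed_measurable mu (f @^-1` V) ->
  shift_continuous S T f ->
  ~ mu.-negligible (T `&` [set t | S (x * t^-1)%g]) ->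
  exists2 O, nbhs x O & mu.-negligible (O `\` f @^-1` V).
Proof.
move=> sG hG sf haar oV Vfx [F0 mF0 [N [P [mP P0 NP]] F0N]].
move=> [tau [Bs cBs [oBs bBs]] ctau] nT.
have [F FT mF] := sf.
have [t0 [Tt0 St0]] : exists t, T t /\ S (x * t^-1)%g.
  apply: contrapT => /forallNP Tx; apply: nT.
  rewrite (_ : _ `&` _ = set0); first exact: negligible_set0.
  by rewrite -subset0 => t; exact: Tx.
(* The shift by [x * t^-1] takes the value [f x] at [t], so its continuity there yields a basic
   neighbourhood of [t] that it sends into [V]. *)
have tauV (t : G) (Tt : T t) : S (x * t^-1)%g ->
    exists U, [/\ Bs U, U (exist _ t (mem_set Tt)) &
                  forall u, U u -> V (f (x * t^-1 * \val u)%g)].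
  move=> St; pose tt : Topological.Pack tau := exist _ t (mem_set Tt).
  have nV : nbhs tt
      [set u : Topological.Pack tau | V (f (x * t^-1 * \val (u : T))%g)].
    apply: (ctau _ St tt); apply: open_nbhs_nbhs; split => //=.
    by rewrite mulgVK.
  have [U [BU Ut] UV] := bBs tt _ nV.
  by exists U.
have [U0 [BU0 _ _]] := tauV _ Tt0 St0.
have [e Be] := countable_enum cBs BU0.
pose B n := [set \val (u : T) | u in (e n : set T)].
pose A n := [set s | S s /\ forall u : T, e n u -> V (f (s * \val u)%g)].
pose Bx n : set (borel G) := B n `&` [set t | A n (x * t^-1)%g].
have [n nBx] : exists n, ~ mu.-negligible (Bx n).
  apply: contrapT => /forallNP nB; apply: nT.
  pose N' : set (borel G) := \bigcup_n Bx n.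
  apply: (@negligibleS _ _ _ _ N'); last first.
    by apply: negligible_bigcup => n; exact: (contrapT (nB _)).
  move=> t [Tt St]; have [U [BU Ut UV]] := tauV _ Tt St.
  move: BU; rewrite Be => -[n _ enU]; exists n => //; split.
    by exists (exist _ t (mem_set Tt)) => //; rewrite enU.
  by split => // u; rewrite enU; exact: UV.
(* Cutting by a set of finite measure gives [Bk] finite outer measure, as [hull_disjoint_null]
   demands. *)
have [k nBk] : exists k, ~ mu.-negligible (Bx n `&` F k).
  apply: contrapT => /forallNP nB; apply: nBx.
  rewrite -[Bx n]setIT FT setI_bigcupr.
  by apply: negligible_bigcup => k; exact: (contrapT (nB _)).
pose Bk : set (borel G) := B n `&` F k.
have Bkoo : mu_ext mu Bk < +oo.
  apply: le_lt_trans (mF k).2; rewrite -(measurable_mu_extE mu (mF k).1).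
  by apply: le_mu_ext => ? [].
have [C [mC BC CB]] := mu_ext_hull mu Bk.
(* A Borel set of points not sent into [V]; it misses only points of the null set [P] among them. *)
pose M : set (borel G) := ~` (F0 `|` P).
have mM : measurable M by apply: measurableC; exact: measurableU.
have FM y : M y -> ~ V (f y).
  move=> My Vy; apply: My; have : (f @^-1` V) y by [].
  by rewrite -F0N => -[]; [left|right; exact: NP].
have [|O xO OM] := @haar_near_null R G mu C M x sG hG sf haar mC mM.
  set CA := _ `&` _; apply/eqP => CA0; apply: nBk.
  apply: (@negligibleS _ _ _ _ CA); last first.
    apply/negligibleP => //; apply: measurableI => //.
    apply: (continuous_preimage_measurable (f := fun t : G => (x * t^-1)%g)).
      apply: continuous_mulg; first by move=> t; exact: cvg_cst.
      exact: invg_continuous.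
    exact: null_shifts_measurable.
  move=> t [[Bt [St Vt]] Ft]; split; first by apply: BC; split.
  (* With [s = x * t^-1] in [A n], all of [s * Bk] is sent into [V] and so avoids [M]; the hull
     turns this disjointness from [Bk] into nullity on [C]. *)
  apply: (hull_disjoint_null mC BC CB Bkoo).
    exact: translate_measurable.
  rewrite -subset0 => c [/= /FM Mc [[u eu uc] _]].
  by apply: Mc; rewrite -uc; exact: Vt.
exists O => //.
pose OMP : set (borel G) := (O `&` M) `|` P.
apply: (@negligibleS _ _ _ _ OMP); last first.
  by apply: negligibleU => //; exists P; split.
move=> y [Oy Vy]; have [Py|nPy] := pselect (P y); first by right.
left; split => // -[F0y|//]; apply: Vy.
by rewrite -F0N; left.
Qed.

Lemma metrizable_hausdorff (R : realType) (T : topologicalType) :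
  metrizable R T -> hausdorff_space T.
Proof.
move=> [c cE] x y xy; apply: (@metric_hausdorff R (Metric.Pack c)).
by move=> A B; rewrite !cE; exact: xy.
Qed.

(** For [y] near [x], almost every [z] near [y] has [f z] within [e / 2] of both [f x] and [f y].
    Neighbourhoods are not null, so such a [z] exists and the triangle inequality bounds the
    distance from [f x] to [f y]. *)
Lemma shift_continuous_continuous (R : realType) (G : topologicalGroupType)
    (mu : {measure set (borel G) -> \bar R}) (X : topologicalType)
    (f : G -> X) (S T : set G) :
  separable G -> @second_countable G -> hausdorff_space G ->
  sigma_finite setT mu -> left_haar mu -> metrizable R X ->
  haar_measurable_fun mu f -> shift_continuous S T f ->
  (forall x, ~ mu.-negligible (T `&` [set t | S (x * t^-1)%g])) ->
  continuous f.
Proof.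
move=> sepG sG hG sf haar [c cE] mf ST nT x A.
pose N : metricType R := Metric.Pack c.
rewrite -[nbhs (f x)]cE => /(@nbhs_ballP R N)[e /= e0 eA].
pose V (y : G) : set X := (@ball R N (f y) (e / 2)%R : set X)^°.
have aeV y : exists2 O, nbhs y O & mu.-negligible (O `\` f @^-1` V y).
  apply: (shift_continuous_near_ae sG hG sf haar _ _ _ ST) => //.
  - exact: open_interior.
  - have : nbhs (f y) (@ball R N (f y) (e / 2)%R).
      by rewrite -cE; apply: (@nbhsx_ballx R N); rewrite divr_gt0.
    by [].
  - by apply: mf; exact: open_interior.
have [U /nbhs_interior xU nU] := aeV x.
apply: filterS xU => y Uy; apply: contrapT => nAy.
have [W yW nW] := aeV y.
apply: (haar_nbhs_not_negligible sepG haar (filterI Uy yW)).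
apply: negligibleS (negligibleU nU nW) => z [Uz Wz].
have [Vz|nVz] := pselect (V x (f z)); last by left.
right; split => // /interior_subset V'z; apply/nAy/eA.
rewrite (splitr e); apply: (@ball_triangle R N (f z)).
  exact: (interior_subset Vz).
exact/ball_sym.
Qed.

(** * The three size conditions *)

Theorem theorem7 (R : realType) (G : topologicalGroupType)
    (mu : {measure set (borel G) -> \bar R}) (X : topologicalType)
    (f : G -> X) (S T : set G) :
  locally_compact [set: G] -> polish R G -> left_haar mu ->
  separable X -> metrizable R X ->
  haar_measurable_fun mu f ->
  completed_measurable mu S ->
  shift_continuous S T f ->
  ((completed_measure mu (~` S) = 0 /\ 0 < mu_ext mu T) \/
   (0 < completed_measure mu S /\ inner_measure mu (~` T) = 0) ->
   continuous f) /\
  (compact [set: G] -> mu [set: G] = 1 ->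
   1 < completed_measure mu S + mu_ext mu T ->
   continuous f).
Proof.
move=> lcG [sepG [c cG _]] haar _ mX mf [S0 mS0 [N nN SE]] [tau tau2 ctau].
have metG : metrizable R G by exists c.
have hG := metrizable_hausdorff metG.
have sG := metrizable_second_countable sepG metG.
have sf := haar_sigma_finite lcG sepG haar.
(* Shift continuity passes to smaller sets of shifts, so [S] may be replaced by its Borel part [S0],
   which has the same measure. *)
have S0S : S0 `<=` S by rewrite -SE; exact: subsetUl.
have ST0 : shift_continuous S0 T f.
  by exists tau => // s0 /S0S; exact: ctau.
have cS : completed_measure mu S = mu S0 by rewrite -SE completed_measureE.
suff key : ((completed_measure mu (~` S) = 0 /\ 0 < mu_ext mu T) \/
   (0 < completed_measure mu S /\ inner_measure mu (~` T) = 0)) \/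
   (mu [set: G] = 1 /\ 1 < completed_measure mu S + mu_ext mu T) ->
   forall x, ~ mu.-negligible (T `&` [set t | S0 (x * t^-1)%g]).
  have cont := shift_continuous_continuous sepG sG hG sf haar mX mf ST0.
  by split=> [h|_ h1 h2]; apply: cont; apply: key; [left|right].
move=> + x nP; have [P [mP P0 TP]] := nP.
have {}nP : mu.-negligible P by exists P; split.
pose Sx : set (borel G) := [set t | S0 (x * t^-1)%g].
have mSx : measurable Sx.
  apply: (continuous_preimage_measurable (f := (fun t => x * t^-1)%g)) => //.
  apply: continuous_mulg; first by move=> t; exact: cvg_cst.
  exact: invg_continuous.
(* If the intersection were null, [T] would lie in the complement of [Sx] up to the null set [P];
   each size condition contradicts this. *)
have TP' : T `<=` P `|` ~` Sx.
  move=> t Tt; have [St|] := pselect (S0 (x * t^-1)%g); last by right.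
  by left; apply: TP.
case=> [[[cS0 T0]|[]]|[]].
- have [Q [mQ Q0 NQ]] := nN.
  have mD : measurable (~` S0 `\` Q).
    by apply: measurableD => //; exact: measurableC.
  (* A Borel set plus a negligible one, the form in which [completed_measureE] evaluates the
     completion. *)
  have CSE : ~` S = (~` S0 `\` Q) `|` ((~` S0 `&` Q) `\` N).
    rewrite -SE; apply/seteqP; split => t.
      move=> nS; have nt : ~ S0 t /\ ~ N t.
        by split=> ?; apply: nS; [left|right].
      by have [Qt|Qt] := pselect (Q t); [right|left]; case: nt.
    move=> [[nSt nQt]|[[nSt _] nNt]] [//|//].
    by move=> /NQ.
  have S0C : mu (~` S0) = 0.
    have nS0Q : mu.-negligible ((~` S0 `&` Q) `\` N).
      by exists Q; split => // t [[]].
    move: cS0; rewrite CSE completed_measureE// => D0.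
    apply/negligibleP; first exact: measurableC.
    apply: (@negligibleS _ _ _ _ ((~` S0 `\` Q) `|` Q)).
      by move=> t nSt; have [Qt|Qt] := pselect (Q t); [right|left].
    by apply: negligibleU; [exists (~` S0 `\` Q); split|exists Q; split].
  move: T0; rewrite lt0e => /andP[/eqP T0 _]; apply: T0.
  apply/negligible_mu_ext; apply: (@negligibleS _ _ _ _ (P `|` ~` Sx)) => //.
  apply: (negligibleU nP).
  apply/negligibleP; first exact: measurableC.
  apply: (haar_div_null x sG sf haar (measurableC mS0)).2.
  exact: S0C.
- rewrite cS => S00 iT.
  (* This Borel set avoids [T], so the inner measure of the complement of [T] bounds its measure by
     zero. Then [Sx], and with it [S0], would be null. *)
  have mD : measurable (Sx `\` P) by exact: measurableD.
  have D0 : mu (Sx `\` P) = 0.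
    apply/eqP; rewrite -measure_le0 -iT; apply: ereal_sup_ubound.
    exists (Sx `\` P) => //; split => // t [St nPt] Tt.
    by apply/nPt/TP.
  have : mu Sx = 0.
    apply/negligibleP; first exact: mSx.
    apply: (@negligibleS _ _ _ _ ((Sx `\` P) `|` P)).
      by move=> t St; have [Pt|Pt] := pselect (P t); [right|left].
    by apply: negligibleU nP; exists (Sx `\` P); split.
  move=> /(haar_div_null x sG sf haar mS0) S00'.
  by move: S00; rewrite S00' ltxx.
- move=> G1; rewrite cS.
  (* Total mass one makes [mu] invariant under inversion, so the measures of [S0] and [T] would add
     up to at most that of [Sx] and its complement, which is one. *)
  have muS : mu Sx = mu S0.
    pose B : set (borel G) := [set u | S0 (x * u)%g].
    have mB : measurable B by exact: translate_measurable.
    have := haar_inv_mul sG sf haar mB.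
    by rewrite G1 !mule1 (haar_translate x haar mS0).
  have mCSx : measurable (~` Sx) by exact: measurableC.
  have Tle : mu_ext mu T <= mu (~` Sx).
    rewrite -(measureU0 mCSx mP P0) -measurable_mu_extE.
      by apply: le_mu_ext; rewrite setUC.
    exact: measurableU.
  rewrite ltNge => /negP; apply.
  apply: (le_trans (leeD2l (mu S0) Tle)).
  rewrite -muS -G1 -(setvU Sx) setUC measureU ?setICr//.
Qed.
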